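(* The sporadic simple Mathieu group $M_{24}$ (of order $244823040$) has an Ordered Generating System.
   Context: Definition. A sequence of elements $a_1,\ldots,a_n$ of a group $G$ is an Ordered Generating System of $G$ if there exist non-negative integers $m_1,\ldots,m_n$ such that every element $g\in G$ has a unique representation of the form $g=a_1^{i_1}a_2^{i_2}\cdots a_n^{i_n}$ with integers $0\le i_k\le m_k$ for every $1\le k\le n$ (i.e. the exponent tuple $(i_1,\ldots,i_n)$ in this range exists and is unique). A group is said to have an Ordered Generating System if such a finite sequence exists. *)

(* Defs.v *)
From HB Require Import structures.
From mathcomp Require Import all_boot all_order all_algebra all_fingroup.

Set Implicit Arguments.
Unset Strict Implicit.
Unset Printing Implicit Defensive.

Import GroupScope GRing.Theory.

(* Only finite groups are considered: the exponents are bounded, so a group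
   with an ordered generating system is finite. *)
Definition is_OGS (gT : finGroupType) (G : {group gT}) (n : nat)
    (a : 'I_n -> gT) : Prop :=
  (forall k : 'I_n, a k \in G) /\
  exists m : 'I_n -> nat, forall g : gT, g \in G ->
    exists! i : {ffun 'I_n -> nat},
      (forall k : 'I_n, i k <= m k) /\ g = \prod_(k < n) a k ^+ i k.

Definition has_OGS (gT : finGroupType) (G : {group gT}) : Prop :=
  exists (n : nat) (a : 'I_n -> gT), is_OGS G a.

(* The set N = {0} U {non-squares} of F_23. *)
Definition golayN (x : 'F_23) : bool :=
  (x == 0%R) || ~~ [exists y : 'F_23, y ^+ 2 == x]%R.

(* The row space of this matrix is the extended binary Golay code in its
   quadratic residue form (Conway and Sloane, Sphere Packings, Lattices and
   Groups, ch. 10).  The coordinates are the points of the projective line over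
   F_23: j < 23 stands for the residue class of j, and 23 for infinity.
   Row i < 23 is the indicator of the translate i + N, and row 23 is the
   all-ones word.  The rows are not independent: the rank is 12. *)
Definition golay_mx : 'M['F_2]_24 :=
  (\matrix_(i < 24, j < 24)
     ((i == ord_max) || (j != ord_max) && golayN (j%:R - i%:R))%:R)%R.

(* Right multiplication by [perm_mx s] moves coordinate i to coordinate s i, so
   this is the automorphism group of the Golay code. *)
Definition M24_set : {set 'S_24} :=
  [set s : 'S_24 | stablemx golay_mx (perm_mx s)].

Lemma M24_group_set : group_set M24_set.
Proof.
apply/group_setP; split=> [|s t]; rewrite !inE.
  by rewrite perm_mx1 mulmx1.
by move=> Hs Ht; rewrite perm_mxM; apply: stablemxM.
Qed.

Definition M24 : {group 'S_24} := Group M24_group_set.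

(* Main.v *)
(* A base of seven points has a stabiliser chain in M24 with basic orbits of
   lengths 24, 23, 22, 21, 20, 3, 16 and trivial last term.  If H is the
   stabiliser of b in K and Y is a set of points, then
   {g in K | g b in Y u Y^a u ... u Y^(a^m)} is the set of products h a^i with
   h in {g in K | g b in Y} and i <= m, uniquely if the union is disjoint.  So an
   orbit grown from its base point one segment 1, a, ..., a^m at a time turns
   unique representations in H into unique representations in K, and the group
   order comes out as the product of the segment lengths.
   That the orbits are no longer than claimed follows from the minimum weight 8
   of the Golay code: an automorphism fixing F pointwise preserves every codeword
   with at most 3 points outside F. *)

Require Import Defs.
From mathcomp Require Import all_boot all_order all_algebra all_fingroup.
From mathcomp Require Import zify.
From Stdlib Require Import PeanoNat.

Set Implicit Arguments.
Unset Strict Implicit.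
Unset Printing Implicit Defensive.

Import GroupScope GRing.Theory.

(** * Unique factorisation along a sequence of segments *)

Section Tiling.

Variables (gT : finGroupType) (a : nat -> gT) (m : nat -> nat).

Definition bounded n (i : nat -> nat) := forall k, k < n -> i k <= m k.

Definition segment_prod n (i : nat -> nat) := \prod_(k < n) a k ^+ i k.

(** The cardinality clause carries the group order through the induction. Exponents are total
    functions, so uniqueness compares only the indices below [n]. *)
Definition tiles n (A : {set gT}) : Prop :=
  [/\ #|A| = (\prod_(k < n) (m k).+1)%N,
      forall i, bounded n i -> segment_prod n i \in A,
      forall g, g \in A -> exists2 i, bounded n i & g = segment_prod n i
    & forall i j, bounded n i -> bounded n j ->
        segment_prod n i = segment_prod n j -> forall k, k < n -> i k = j k].

Lemma tiles0 : tiles 0 [set 1].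
Proof.
split=> [|i _|g /set1P ->|//]; first by rewrite cards1 big_ord0.
  by rewrite /segment_prod big_ord0 set11.
by exists (fun=> 0) => //; rewrite /segment_prod big_ord0.
Qed.

Lemma segment_prodS n i :
  segment_prod n.+1 i = segment_prod n i * a n ^+ i n.
Proof. by rewrite /segment_prod big_ord_recr. Qed.

(** The counting identity says at once that the translates of [A] by the [a n ^+ j] are disjoint and
    have union [B]. *)
Lemma tilesS n (A B : {set gT}) :
    (forall g, (g \in B : nat) = \sum_(j < (m n).+1) ((g * a n ^- j)%g \in A)) ->
  tiles n A -> tiles n.+1 B.
Proof.
move=> defB [cardA prodA genA injA].
have boundW i : bounded n.+1 i -> bounded n i by move=> bi k /ltnW; apply: bi.
have inB g j : j <= m n -> g * a n ^- j \in A -> g \in B.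
  move=> le_j Agj; apply: contraTT Agj => notBg.
  move: (defB g); rewrite (negbTE notBg) (bigD1 (inord j)) //= inordK //.
  by case: (_ \in A).
have uniqB g (j k : nat) : j <= m n -> k <= m n ->
  g * a n ^- j \in A -> g * a n ^- k \in A -> j = k.
  move=> le_j le_k Agj Agk; apply/eqP; apply: contraT => neq_jk.
  move: (defB g); rewrite (inB g j) // (bigD1 (inord j)) //=.
  rewrite (bigD1 (inord k)) /=; last first.
    by apply: contraNneq neq_jk => /(congr1 val); rewrite /= !inordK // => ->.
  by rewrite !inordK // Agj Agk.
split.
(* Double counting: each of the [(m n).+1] translates has as many elements as [A]. *)
- rewrite -sum1_card big_mkcond /=.
  under eq_bigr => g _ do rewrite -[if _ then _ else _]/(nat_of_bool _) defB.
  rewrite exchange_big /= [RHS]big_ord_recr /= -cardA.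
  rewrite (eq_bigr (fun=> #|A|)) => [|j _].
    by rewrite sum_nat_const card_ord mulnC.
  rewrite (reindex_inj (mulIg (a n ^+ j))) /= -sum1_card [RHS]big_mkcond /=.
  by apply: eq_bigr => g _; rewrite mulgK; case: (g \in A).
- move=> i bi; apply: (inB _ (i n)); first exact: bi.
  by rewrite segment_prodS mulgK prodA //; apply: boundW.
- move=> g Bg; have /existsP[j Agj] : [exists j : 'I_(m n).+1, g * a n ^- j \in A].
    apply: contraTT Bg => /existsPn noA; rewrite -eqb0 defB big1 // => j _.
    by rewrite (negbTE (noA j)).
  have [i bi def_g] := genA _ Agj.
  exists (fun k => if k == n then j : nat else i k) => [k|].
    rewrite ltnS leq_eqVlt; case: (eqVneq k n) => [-> _|_ /= /bi //].
    by rewrite -ltnS ltn_ord.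
  rewrite segment_prodS eqxx -[LHS](mulgKV (a n ^+ j)) def_g; congr (_ * _).
  by apply: eq_bigr => k _; rewrite ltn_eqF.
move=> i j bi bj; rewrite !segment_prodS => eq_ij.
have eq_n : i n = j n.
  apply: (uniqB (segment_prod n i * a n ^+ i n)); try by [apply: bi | apply: bj].
    by rewrite mulgK prodA //; apply: boundW.
  by rewrite eq_ij mulgK prodA //; apply: boundW.
move: eq_ij; rewrite eq_n => /mulIg eq_ij k.
rewrite ltnS leq_eqVlt => /predU1P[-> //|].
by apply: injA eq_ij k; apply: boundW.
Qed.

Lemma tiles_OGS n (G : {group gT}) :
  tiles n G -> (forall k, k < n -> a k \in G) -> has_OGS G.
Proof.
case=> _ _ genG injG Ga; exists n, (fun k => a k); split=> [k|]; first exact: Ga.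
exists (fun k => m k) => g /genG[i bi def_g]; exists [ffun k : 'I_n => i k]; split.
  split=> [k|]; first by rewrite ffunE bi.
  by rewrite def_g; apply: eq_bigr => k _; rewrite ffunE.
move=> j [bj def_gj]; apply/ffunP=> k; rewrite ffunE.
(* The finite exponent function is extended by 0 to all naturals, to fit [bounded] and
   [segment_prod]. *)
pose j' l := if insub l is Some l' then j l' else 0.
have j'E (l : 'I_n) : j' l = j l by rewrite /j' valK.
rewrite -j'E; apply: injG bi _ _ _ (ltn_ord k).
  by move=> l lt_ln; rewrite -[l]/(val (Ordinal lt_ln)) j'E bj.
by rewrite -def_g def_gj; apply: eq_bigr => l _; rewrite j'E.
Qed.

End Tiling.

(** * Binary words and their spans *)

(* Words are coordinate lists; unlike row spaces of matrices over 'F_2, their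
   spans can be enumerated by computation. *)
Definition xorw (u v : seq bool) := [seq p.1 (+) p.2 | p <- zip u v].

Definition span_words : seq (seq bool) -> seq (seq bool) :=
  foldr (fun b ws => ws ++ map (xorw b) ws) [:: nseq 24 false].

Definition row_of (w : seq bool) : 'rV['F_2]_24 :=
  (\row_(j < 24) (nth false w j)%:R)%R.

Definition word_of (v : 'rV['F_2]_24) : seq bool :=
  mkseq (fun j => v ord0 (inord j) != 0%R) 24.

Lemma word_ofK : cancel word_of row_of.
Proof.
move=> v; apply/rowP=> j; rewrite mxE nth_mkseq // inord_val.
by case: (v _ _) => [[|[|//]] lt]; apply/val_inj.
Qed.

Lemma row_ofK w : size w = 24 -> word_of (row_of w) = w.
Proof.
move=> sz_w; apply: (@eq_from_nth _ false) => [|j]; rewrite size_mkseq // => lt_j.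
by rewrite nth_mkseq // mxE inordK //; case: nth.
Qed.

Lemma size_xorw u v : size u = 24 -> size v = 24 -> size (xorw u v) = 24.
Proof. by move=> su sv; rewrite size_map size_zip su sv. Qed.

Lemma row_of_xor u v :
  size u = 24 -> size v = 24 -> row_of (xorw u v) = (row_of u + row_of v)%R.
Proof.
move=> su sv; apply/rowP=> j; rewrite !mxE.
rewrite (nth_map (false, false)) ?size_zip ?su ?sv // nth_zip ?su ?sv //=.
by do 2!case: nth; apply/val_inj.
Qed.

Lemma size_span_words Bs w :
  all (fun b => size b == 24) Bs -> w \in span_words Bs -> size w = 24.
Proof.
elim: Bs w => [|b Bs IH] w /=; first by rewrite inE => _ /eqP->.
case/andP=> /eqP sb sBs; rewrite mem_cat => /orP[|/mapP[u su ->]]; first exact: IH.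
by rewrite size_xorw // (IH u).
Qed.

(** Over F_2 the line through [b] is {0, b}, so a new generator adds exactly the translate of the
    previous span by [b]. *)
Lemma span_wordsE Bs v : all (fun b => size b == 24) Bs ->
  (v <= \sum_(b <- Bs) <<row_of b>>)%MS = (word_of v \in span_words Bs).
Proof.
have word0 : word_of 0%R = nseq 24 false.
  rewrite -[RHS]row_ofK ?size_nseq //; congr word_of; apply/rowP=> j.
  by rewrite !mxE nth_nseq ltn_ord.
elim: Bs v => [|b Bs IH] v.
  rewrite big_nil submx0 inE -word0 => _.
  by apply/eqP/eqP=> [->//|/(can_inj word_ofK)].
case/andP=> /eqP sb sBs; rewrite big_cons [span_words _]/= mem_cat.
have IHv u := IH u sBs; apply/idP/orP.
  case/sub_addsmxP=> -[u1 u2] /= def_v.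
  have: ((u1 *m <<row_of b>>%MS)%R <= row_of b)%MS by rewrite -(genmxE (row_of b)) submxMl.
  case/sub_rVP=> c def_c; rewrite def_c in def_v.
  set v2 := (u2 *m _)%R in def_v; have Sv2 : word_of v2 \in span_words Bs.
    by rewrite -IHv submxMl.
  have [c0|c1] : c = 0%R \/ c = 1%R.
    by case: c {def_c def_v} => [[|[|//]] ltc]; [left | right]; apply/val_inj.
    by left; rewrite def_v c0 scale0r add0r.
  right; apply/mapP; exists (word_of v2) => //.
  rewrite -[RHS]row_ofK ?size_xorw ?size_mkseq // row_of_xor ?size_mkseq //.
  by rewrite word_ofK def_v c1 scale1r.
case=> [|/mapP[w Sw def_v]].
  by rewrite -IHv => /submx_trans; apply; apply: addsmxSr.
have sw := size_span_words sBs Sw.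
rewrite -(word_ofK v) def_v row_of_xor // addmx_sub_adds ?genmxE //.
by rewrite IHv row_ofK.
Qed.

(** * The Golay code as an explicit list of words *)

Definition nonsquare_or_0 x :=
  (x == 0) || ~~ has (fun y => y * y %% 23 == x) (iota 0 23).

(** Adding [23 - i] stands for subtracting [i] modulo 23, since subtraction of naturals
    truncates. *)
Definition golay_word i :=
  [seq (i == 23) || (j != 23) && nonsquare_or_0 ((j + (23 - i)) %% 23)
  | j <- iota 0 24].

(* These twelve rows of [golay_mx] already span its row space. *)
Definition golay_basis := [seq golay_word i | i <- rcons (iota 0 11) 23].

Definition code := span_words golay_basis.

Lemma golayN_val (x : 'F_23) : golayN x = nonsquare_or_0 x.
Proof.
congr (_ || ~~ _); apply/existsP/hasP=> [[y /eqP def_x]|[y]].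
  exists (val y); first by rewrite mem_iota ltn_ord.
  by rewrite -def_x expr2.
rewrite mem_iota /= => lt_y /eqP def_x; exists (inord y : 'I_23).
by rewrite -val_eqE expr2 /= inordK ?def_x.
Qed.

Lemma golay_row i : row i golay_mx = row_of (golay_word i).
Proof.
apply/rowP=> j; rewrite !mxE (nth_map 0) ?size_iota // nth_iota // add0n.
rewrite -!val_eqE [val (ord_max : 'I_24)]/= golayN_val.
have [//|ne_i] := eqVneq (val i) 23; have [//|ne_j] := eqVneq (val j) 23.
have lt_i : i < 23 by rewrite ltn_neqAle ne_i -ltnS ltn_ord.
have lt_j : j < 23 by rewrite ltn_neqAle ne_j -ltnS ltn_ord.
suff -> : val (j%:R - i%:R : 'F_23)%R = (j + (23 - i)) %% 23 by [].
rewrite [LHS]/= !(@val_Fp_nat 23) //.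
by rewrite !(modn_small lt_i, modn_small lt_j) modnDmr.
Qed.

Lemma size_golay_basis : all (fun b => size b == 24) golay_basis.
Proof. by []. Qed.

Lemma golay_words_in_code : all (fun i => golay_word i \in code) (iota 0 24).
Proof. by vm_compute. Qed.

(** The bound 6 is chosen for sums supported on two sets of at most 3 points each. *)
Lemma code_min_weight :
  all (fun w => (w == nseq 24 false) || (6 < count id w)) code.
Proof. by vm_compute. Qed.

(** One inclusion is the computed check on all 24 rows; the other holds because the basis consists
    of rows. *)
Lemma golay_code v : (v <= golay_mx)%MS = (word_of v \in code).
Proof.
rewrite -span_wordsE ?size_golay_basis //; apply/idP/idP => /submx_trans; apply.
  apply/row_subP=> i; rewrite golay_row span_wordsE ?size_golay_basis // row_ofK.
    by apply: (allP golay_words_in_code); rewrite mem_iota ltn_ord.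
  by rewrite size_map size_iota.
rewrite big_map big_seq; elim/big_rec: _ => [|i A]; first exact: sub0mx.
rewrite mem_rcons inE mem_iota => le_i sAG.
rewrite addsmx_sub genmxE sAG andbT.
have lt_i : i < 24 by case/predU1P: le_i => [->//|/ltn_trans]; apply.
by rewrite -[i]/(val (Ordinal lt_i)) -golay_row row_sub.
Qed.

Lemma size_code w : w \in code -> size w = 24.
Proof. exact: size_span_words size_golay_basis. Qed.

Lemma code_xor u v : u \in code -> v \in code -> xorw u v \in code.
Proof.
move=> Cu Cv; have [su sv] := (size_code Cu, size_code Cv).
rewrite -(row_ofK (size_xorw su sv)) -golay_code row_of_xor //.
by rewrite addmx_sub // golay_code row_ofK.
Qed.

(** * Automorphisms acting on codewords *)

Definition moved_word (s : 'S_24) w :=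
  mkseq (fun j => nth false w (s (inord j))) 24.

(** Reading [w] at [s j] applies the inverse of [s] to the coordinates, hence the passage to [s^-1]
    in the next two proofs. *)
Lemma row_moved_word s w :
  row_of (moved_word s w) = (row_of w *m perm_mx s^-1)%R.
Proof.
rewrite -col_permE; apply/rowP=> j.
by rewrite !mxE nth_mkseq // inord_val.
Qed.

Lemma M24_moved_word s w : s \in M24 -> w \in code -> moved_word s w \in code.
Proof.
move=> Ms Cw; rewrite -[moved_word s w]row_ofK ?size_mkseq // -golay_code.
rewrite row_moved_word; have := groupVr Ms; rewrite inE; apply: submx_trans.
by rewrite submxMr // golay_code row_ofK // size_code.
Qed.

Lemma moved_word_M24 s :
  (forall w, w \in golay_basis -> moved_word s w \in code) -> s \in M24.
Proof.
move=> Cs; rewrite -groupV inE.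
have /submxMr : (golay_mx <= \sum_(b <- golay_basis) <<row_of b>>)%MS.
  apply/row_subP=> i; rewrite span_wordsE ?size_golay_basis //.
  by rewrite -golay_code row_sub.
move/(_ _ (perm_mx s^-1))/submx_trans; apply.
rewrite big_seq; elim/big_rec: _ => [|w A Bw sAG]; first by rewrite mul0mx sub0mx.
rewrite addsmxMr addsmx_sub sAG andbT (eqmxMr _ (genmxE _)) -row_moved_word.
by rewrite golay_code row_ofK ?size_mkseq // Cs.
Qed.

(** Points are naturals so that lists of them can be computed with; [inord] reads anything above 23
    as 0, hence the bounds [x < 24] below. *)
Definition act (s : 'S_24) x : nat := s (inord x).

Definition weight_outside (F : seq nat) w :=
  count (fun p => p.1 && p.2) (zip w (mkseq (fun x => x \notin F) 24)).

Lemma count_word w :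
  size w = 24 -> count id w = #|[set j : 'I_24 | nth false w j]|.
Proof.
by move=> sw; rewrite -sum1_count (big_nth false) big_mkord sw sum1dep_card.
Qed.

Lemma weight_outsideE F w : size w = 24 ->
  weight_outside F w = #|[set j : 'I_24 | nth false w j && (val j \notin F)]|.
Proof.
move=> sw; rewrite /weight_outside -(count_map _ id) count_word.
  apply: eq_card => j.
  rewrite !inE (nth_map (false, false)) ?size_zip ?size_mkseq ?sw //.
  by rewrite nth_zip ?size_mkseq //= nth_mkseq.
by rewrite size_map size_zip sw size_mkseq.
Qed.

(* The sum of w and its translate by s is a codeword supported on the points of
   w outside F and their preimages, so it has weight at most 6 and vanishes. *)
Lemma light_word_fixed s F w (x : 'I_24) :
    s \in M24 -> all (fun y => act s y == y) F -> w \in code ->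
  weight_outside F w <= 3 -> nth false w (s x) = nth false w x.
Proof.
move=> Ms /allP fixF Cw; have sw := size_code Cw; rewrite weight_outsideE //.
set D := [set j | _] => leD.
have fixFo (y : 'I_24) : val y \in F -> s y = y.
  by move/fixF/eqP; rewrite /act inord_val => /val_inj.
have Cd := code_xor Cw (M24_moved_word Ms Cw).
have nth_d (j : 'I_24) :
  nth false (xorw w (moved_word s w)) j = nth false w j (+) nth false w (s j).
  rewrite (nth_map (false, false)) ?size_zip ?size_mkseq ?sw //.
  by rewrite nth_zip ?size_mkseq //= nth_mkseq // inord_val.
have: count id (xorw w (moved_word s w)) <= 6.
  rewrite count_word ?size_code //.
  apply: leq_trans (_ : #|D :|: s @^-1: D| <= _); last first.
    apply: leq_trans (leq_card_setU _ _) _.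
    by rewrite (card_preimset _ (@perm_inj _ s)) (leq_add leD leD).
  apply/subset_leq_card/subsetP=> j; rewrite !inE nth_d.
  have [Fj|] := boolP (val j \in F); first by rewrite (fixFo j Fj) addbb.
  (* If [s j] lies in [F] it is fixed, so injectivity gives [s j = j] and the two terms cancel
     again. *)
  have [Fsj|] := boolP (val (s j) \in F); last by rewrite !andbT; do 2!case: nth.
  by rewrite (perm_inj (fixFo _ Fsj)) addbb.
have /orP[/eqP d0 _|] := allP code_min_weight _ Cd; last first.
  by rewrite ltnNge => /negbTE->.
have := nth_d x; rewrite d0 nth_nseq ltn_ord.
by case: (nth _ w x); case: (nth _ w (s x)).
Qed.

Lemma act_ltn s x : act s x < 24.
Proof. exact: ltn_ord. Qed.

Lemma actM s t x : act (s * t) x = act t (act s x).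
Proof. by rewrite /act permM inord_val. Qed.

Lemma act1 x : x < 24 -> act 1 x = x.
Proof. by move=> lt_x; rewrite /act perm1 inordK. Qed.

Lemma actK s x y : x < 24 -> y < 24 -> (act s x == y) = (x == act s^-1 y).
Proof.
move=> lt_x lt_y; apply/eqP/eqP=> [<-|->]; rewrite -actM ?mulgV ?mulVg act1 //.
Qed.

(** * Pointwise stabilisers and bounds on their orbits *)

Definition stab F : {set 'S_24} := [set s in M24 | all (fun x => act s x == x) F].

Lemma stabE s F : (s \in stab F) = (s \in M24) && all (fun x => act s x == x) F.
Proof. by rewrite [LHS]inE. Qed.

Definition light_words F := [seq w <- code | weight_outside F w <= 3].

(** With the light words for [ws], this bounds the orbit of a point [x] outside [F] under [stab F]
    from above. *)
Definition indistinct (ws : seq (seq bool)) (F : seq nat) x :=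
  [seq y <- iota 0 24 |
    (y \notin F) && all (fun w => nth false w y == nth false w x) ws].

(** A point that the light words separate from all others outside [F] is fixed by [stab F]. *)
Definition closure F :=
  let ws := light_words F in
  [seq x <- iota 0 24 | (x \in F) || (indistinct ws F x == [:: x])].

Lemma closure_ltn F : all (gtn 24) (closure F).
Proof. by apply/allP=> x; rewrite mem_filter mem_iota => /andP[]. Qed.

Lemma act_indistinct s F x :
    s \in stab F -> all (gtn 24) F -> x < 24 -> x \notin F ->
  act s x \in indistinct (light_words F) F x.
Proof.
rewrite stabE => /andP[Ms fixF] /allP F24 lt_x notFx.
rewrite mem_filter mem_iota act_ltn !andbT; apply/andP; split.
  apply: contra notFx => Fsx; have:= allP fixF _ Fsx; rewrite actK ?act_ltn //.
  by rewrite -actM mulgV act1 // => /eqP <-.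
apply/allP=> w; rewrite mem_filter => /andP[light_w Cw].
by have:= light_word_fixed (inord x) Ms fixF Cw light_w; rewrite inordK // => ->.
Qed.

Lemma stab_closure F : all (gtn 24) F -> stab F \subset stab (closure F).
Proof.
move=> F24; apply/subsetP=> s Ss; have:= Ss; rewrite !stabE => /andP[-> /allP fixF] /=.
apply/allP=> x; rewrite mem_filter mem_iota /= => /andP[clx lt_x].
have [/fixF // | notFx] := boolP (x \in F); move: clx; rewrite (negbTE notFx) /=.
by have:= act_indistinct Ss F24 lt_x notFx => /[swap] /eqP->; rewrite inE.
Qed.

Lemma stab_all : stab (iota 0 24) = [set 1].
Proof.
apply/setP=> s; rewrite stabE !in_set1; apply/andP/eqP=> [[_ /allP fixs]|->].
  apply/permP=> x; rewrite perm1; apply/val_inj/eqP.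
  by have:= fixs x; rewrite mem_iota ltn_ord /act inord_val; apply.
by split; [apply: group1 | apply/allP=> x; rewrite mem_iota => lt_x; rewrite act1].
Qed.

(** * Permutations given by lists of images *)

(* The identity when p is not a permutation of 0, ..., 23. *)
Definition perm_of (p : seq nat) : 'S_24 :=
  insubd (1 : 'S_24) [ffun x : 'I_24 => inord (nth 0 p x)].

Lemma act_perm_of p x :
  perm_eq p (iota 0 24) -> x < 24 -> act (perm_of p) x = nth 0 p x.
Proof.
move=> p_iota lt_x; have sp : size p = 24 by rewrite (perm_size p_iota).
have lt_p y : y < 24 -> nth 0 p y < 24.
  move=> lt_y; have := mem_nth 0 (_ : y < size p).
  by rewrite sp (perm_mem p_iota) mem_iota; apply.
rewrite /act -pvalE /perm_of insubdK.
  by rewrite ffunE !inordK // lt_p.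
apply/injectiveP=> y z; rewrite !ffunE => /(congr1 val); rewrite /= !inordK ?lt_p //.
move/eqP; rewrite nth_uniq ?sp //; last by rewrite (perm_uniq p_iota) iota_uniq.
by move/eqP/val_inj.
Qed.

Definition automorphism_word (p : seq nat) :=
  perm_eq p (iota 0 24) && all (fun w => map (nth false w) p \in code) golay_basis.

Lemma perm_of_M24 p : automorphism_word p -> perm_of p \in M24.
Proof.
case/andP=> p_iota /allP Cp; apply: moved_word_M24 => w /Cp.
have sp : size p = 24 by rewrite (perm_size p_iota).
suff <- : map (nth false w) p = moved_word (perm_of p) w by [].
apply: (@eq_from_nth _ false); rewrite size_map sp ?size_mkseq // => j lt_j.
rewrite (nth_map 0) ?sp // nth_mkseq //; congr (nth _ _ _).
exact/esym/act_perm_of.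
Qed.

(** * Growing orbits by segments and climbing the stabiliser chain *)

Definition level F b (Y : seq nat) : {set 'S_24} :=
  [set s in stab F | act s b \in Y].

Definition segment_orbit (p : seq nat) m (Y : seq nat) :=
  flatten [seq [seq iter j (nth 0 p) y | y <- Y] | j <- iota 0 m.+1].

(** The powers of the permutation lie in [stab F], so only the image of [b] matters. The orbit list
    has no repetition, so membership is a multiplicity, which adds up over the translates of [Y]. *)
Lemma level_segment F b Y p m g :
    automorphism_word p -> all (gtn 24) F -> all (fun x => nth 0 p x == x) F ->
    uniq Y -> all (gtn 24) Y -> uniq (segment_orbit p m Y) ->
  (g \in level F b (segment_orbit p m Y) : nat)
    = \sum_(j < m.+1) ((g * perm_of p ^- j)%g \in level F b Y).
Proof.
move=> aut_p /allP F24 /allP fixp uniqY /allP Y24 uniq_orb.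
have [p_iota _] := andP aut_p; set s := perm_of p.
have Ss j : s ^+ j \in stab F -> s ^- j \in stab F.
  rewrite !stabE groupV => /andP[-> /allP fixF]; apply/allP=> x Fx.
  by have lt_x := F24 x Fx; rewrite eq_sym -actK // fixF.
have stabM u v : u \in stab F -> v \in stab F -> u * v \in stab F.
  rewrite !stabE => /andP[Mu /allP fu] /andP[Mv /allP fv]; rewrite groupM //.
  by apply/allP=> x Fx; rewrite actM (eqP (fu x Fx)) fv.
have stab1 : 1 \in stab F by rewrite stabE group1; apply/allP=> x /F24 /act1->.
have stabs : s \in stab F.
  rewrite stabE perm_of_M24 //; apply/allP=> x Fx.
  by have lt_x := F24 x Fx; rewrite act_perm_of // fixp.
have stabX j : s ^+ j \in stab F.
  by elim: j => [|j IH]; rewrite ?expg0 // expgS stabM.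
have [Sg|notSg] := boolP (g \in stab F); last first.
  rewrite inE (negbTE notSg) big1 // => j _; rewrite inE.
  case: (boolP (_ \in stab F)) => //= Sgs; case/negP: notSg.
  by rewrite -[g](mulgKV (s ^+ j)); exact: stabM Sgs (stabX j).
rewrite inE Sg /= -(count_uniq_mem _ uniq_orb) count_flatten -map_comp sumnE big_map.
rewrite -[iota 0 m.+1]/(index_iota 0 m.+1) big_mkord; apply: eq_bigr => j _.
rewrite inE (stabM _ _ Sg (Ss _ (stabX j))) /= -(count_uniq_mem _ uniqY) count_map actM.
apply: eq_in_count => y /Y24 lt_y /=; rewrite -actK ?act_ltn //; congr (_ == _).
elim: (nat_of_ord j) => [|k IH]; first by rewrite expg0 act1.
by rewrite expgSr actM -IH /= act_perm_of // IH act_ltn.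
Qed.

(** The final test says that [Y] has absorbed every possible image of [b], so that [level F b Y] is
    all of [stab F]. *)
Fixpoint orbit_ok F b Y (segs : seq (seq nat * nat)) :=
  if segs is (p, m) :: segs' then
    [&& uniq Y, all (gtn 24) Y, all (fun x => nth 0 p x == x) F,
        uniq (segment_orbit p m Y) & orbit_ok F b (segment_orbit p m Y) segs']
  else all (mem Y) (indistinct (light_words F) F b).

Fixpoint chain_ok base (levels : seq (seq (seq nat * nat))) :=
  match base, levels with
  | [::], [::] => true
  | b :: F, segs :: levels' =>
      [&& b < 24, b \notin F, all (gtn 24) F, orbit_ok F b [:: b] segs
        & chain_ok F levels']
  | _, _ => false
  end.

Section Chain.

Variable steps : seq (seq nat * nat).
Hypothesis aut_steps : all (fun x => automorphism_word x.1) steps.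

Let a k := perm_of (nth ([::], 0) steps k).1.
Let m k := (nth ([::], 0) steps k).2.

Lemma orbit_tiles F b segs rest n Y :
    b < 24 -> b \notin F -> all (gtn 24) F -> drop n steps = segs ++ rest ->
    orbit_ok F b Y segs -> tiles a m n (level F b Y) ->
  tiles a m (n + size segs) (stab F).
Proof.
move=> lt_b notFb F24; elim: segs n Y => [|[p l] segs IH] n Y /=.
  move=> _ /allP sY; rewrite addn0; congr tiles; apply/setP=> s; rewrite inE.
  by case: (boolP (s \in stab F)) => //= Ss; apply: sY; apply: act_indistinct.
move=> def_n /and5P[uY Y24 fixp u_orb ok] tY; rewrite addnS -addSn.
have lt_n : n < size steps by rewrite ltnNge; apply/negP=> /drop_oversize; rewrite def_n.
move: def_n; rewrite (drop_nth ([::], 0)) // => -[def_pl def_n].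
apply: IH def_n ok _; apply: tilesS tY => g; rewrite /a /m def_pl.
apply: level_segment => //.
by have:= allP aut_steps _ (mem_nth ([::], 0) lt_n); rewrite def_pl.
Qed.

Lemma chain_tiles base levels n :
    drop n steps = flatten levels -> chain_ok base levels ->
    tiles a m n (stab base) ->
  tiles a m (n + size (flatten levels)) M24.
Proof.
elim: base levels n => [|b F IH] [|segs levels] n //=.
  move=> _ _; rewrite addn0; congr tiles.
  by apply/setP=> s; rewrite stabE andbT.
move=> def_n /and5P[lt_b notFb F24 ok_b okF] tF.
rewrite size_cat addnA; apply: IH okF _.
  by rewrite addnC -drop_drop def_n drop_size_cat.
apply: (orbit_tiles lt_b notFb F24 def_n ok_b).
(* The smaller stabiliser is the level of the one-point list, from which the orbit starts
   growing. *)
suff <- : stab (b :: F) = level F b [:: b] by [].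
apply/setP=> s; rewrite [RHS]inE !stabE mem_seq1 /= -andbA.
by congr (_ && _); rewrite andbC.
Qed.

End Chain.

(** * An explicit chain for M24 *)

(* The first six base points lie in one octad, the last one (4, listed first) does
   not; the deepest stabiliser comes first. *)
Definition M24_base := [:: 4; 9; 3; 2; 1; 0; 23]%N.

(* The pair (p, m) stands for the segment 1, p, ..., p^m.  The permutations come
   from a random search in the point stabilisers for powers that move the orbit
   obtained so far to disjoint sets. *)
Definition M24_levels : seq (seq (seq nat * nat)) :=
  [::
    [:: ([:: 0; 1; 2; 3; 10; 19; 16; 20; 14; 9; 4; 17; 12; 22; 8; 18; 6; 11; 15; 5; 7; 21; 13; 23],
         1);
        ([:: 0; 1; 2; 3; 11; 14; 22; 15; 19; 9; 17; 4; 12; 16; 5; 7; 13; 10; 20; 8; 18; 21; 6; 23],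
         1);
        ([:: 0; 1; 2; 3; 13; 20; 17; 19; 15; 9; 22; 16; 12; 4; 18; 8; 11; 6; 14; 7; 5; 21; 10; 23],
         1);
        ([:: 0; 1; 2; 3; 7; 22; 14; 4; 16; 9; 20; 15; 12; 19; 6; 11; 8; 18; 17; 13; 10; 21; 5; 23],
         1)];
    [:: ([:: 0; 1; 2; 3; 15; 7; 10; 19; 11; 21; 14; 22; 9; 18; 6; 17; 13; 4; 16; 5; 20; 12; 8; 23],
         2)];
    [:: ([:: 0; 1; 2; 15; 14; 21; 13; 4; 22; 5; 3; 20; 10; 18; 19; 12; 9; 6; 17; 7; 11; 16; 8; 23],
         3);
        ([:: 0; 1; 2; 5; 12; 17; 21; 8; 19; 15; 13; 6; 16; 11; 20; 7; 14; 22; 3; 9; 4; 10; 18; 23],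
         4)];
    [:: ([:: 0; 1; 19; 16; 4; 14; 2; 7; 3; 17; 5; 13; 20; 22; 10; 12; 8; 21; 18; 6; 15; 9; 11; 23],
         2);
        ([:: 0; 1; 9; 18; 22; 6; 15; 17; 3; 8; 7; 21; 10; 16; 20; 11; 5; 19; 4; 14; 12; 13; 2; 23],
         6)];
    [:: ([:: 0; 14; 15; 4; 21; 18; 2; 12; 7; 22; 5; 10; 9; 16; 3; 13; 6; 17; 20; 19; 11; 1; 8; 23],
         1);
        ([:: 0; 2; 4; 6; 8; 10; 12; 14; 16; 18; 20; 22; 1; 3; 5; 7; 9; 11; 13; 15; 17; 19; 21; 23],
         10)];
    [:: ([:: 1; 2; 3; 4; 5; 6; 7; 8; 9; 10; 11; 12; 13; 14; 15; 16; 17; 18; 19; 20; 21; 22; 0; 23],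
         22)];
    [:: ([:: 15; 10; 13; 1; 17; 12; 14; 4; 21; 20; 6; 0; 3; 23; 9; 2; 22; 11; 7; 16; 8; 18; 19; 5],
         1);
        ([:: 5; 18; 8; 20; 12; 21; 10; 11; 9; 14; 3; 2; 19; 4; 1; 22; 6; 0; 17; 23; 13; 7; 16; 15],
         11)]]%N.

Lemma M24_steps_aut :
  all (fun x => automorphism_word x.1) (flatten M24_levels).
Proof. by vm_compute. Qed.

(** Level by level the segment lengths are 2.2.2.2, 3, 4.5, 3.7, 2.11, 23 and 2.12, with products
    16, 3, 20, 21, 22, 23 and 24. *)
Lemma M24_chain_ok : chain_ok M24_base M24_levels.
Proof. by vm_compute. Qed.

(** The points 12 and 21 complete the octad of the six base points other than 4. Any other light
    octad meets it in four base points and contains neither, so they are separated only in the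
    second round, when more words are light. *)
Lemma M24_base_closure : closure (closure M24_base) = iota 0 24.
Proof. by vm_compute. Qed.

Lemma stab_M24_base : stab M24_base = [set 1].
Proof.
apply/eqP; rewrite eqEsubset -{1}stab_all -M24_base_closure.
apply/andP; split; last first.
  by apply/subsetP=> s /set1P->; rewrite stabE group1 /= !act1.
have base_ltn : all (gtn 24) M24_base by [].
exact: subset_trans (stab_closure base_ltn) (stab_closure (closure_ltn _)).
Qed.

Theorem theorem7 : #|M24| = 244823040 /\ has_OGS M24.
Proof.
pose steps := flatten M24_levels.
pose a k := perm_of (nth ([::], 0) steps k).1.
pose m k := (nth ([::], 0) steps k).2.
have tM : tiles a m (size steps) M24.
  have := chain_tiles M24_steps_aut (drop0 _) M24_chain_ok.
  by rewrite stab_M24_base; apply; apply: tiles0.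
split; last first.
  apply: (tiles_OGS tM) => k lt_k; apply: perm_of_M24.
  exact: (allP M24_steps_aut _ (mem_nth ([::], 0) lt_k)).
case: tM => -> _ _ _; rewrite -(big_mkord xpredT (fun k => (m k).+1)).
rewrite -(big_nth _ xpredT (fun x => x.2.+1)) unlock /=.
(* The decimal literal unfolds to nested [Nat.tail_mul]; keeping both products folded avoids unary
   evaluation. *)
cbv -[muln Nat.tail_mul]; rewrite !Nat.tail_mul_spec; lia.
Qed.
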